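(* Let $K_{p,p}$ be the complete bipartite graph with both parts of size $p$. The immorality number of $K_{p,p}$ is $m(K_{p,p})=p\binom{p}{2}$.
   Context: An immorality of a directed acyclic graph (DAG) is an induced subgraph of the form $X\to Z\leftarrow Y$ (with $X,Y$ not adjacent). The immorality number $m(G)$ of an undirected graph $G$ is the maximum number of immoralities over all DAGs whose skeleton (underlying undirected graph) is $G$. *)

(* Defs.v *)
From mathcomp Require Import all_boot.

Set Implicit Arguments.
Unset Strict Implicit.
Unset Printing Implicit Defensive.

Record sgraph := SGraph {
  vertex :> finType;
  adj : rel vertex;
  adj_sym : symmetric adj;
  adj_irr : irreflexive adj }.

(* A digraph on T is its set of arcs, so that digraphs form a finite type:
   (x, y) \in A is the arc x -> y. *)
Section Digraph.
Variable T : finType.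
Implicit Types A : {set T * T}.

Definition arc A : rel T := fun x y => (x, y) \in A.

(* The arc x -> y closes up into a directed cycle (loops and 2-cycles included)
   exactly when there is a directed path from y back to x; see acyclicP. *)
Definition acyclic A : bool :=
  [forall x, forall y, arc A x y ==> ~~ connect (arc A) y x].

Lemma acyclicP A :
  reflect (forall c : seq T, cycle (arc A) c -> c = [::]) (acyclic A).
Proof.
apply: (iffP forallP) => [acA [|x [|y c]] //= | noc x].
- rewrite andbT => xx; have /forallP/(_ x) := acA x.
  by rewrite xx connect0.
- case/andP=> xy pth; have /forallP/(_ y) := acA x; rewrite xy /=.
  case/connectP; exists (rcons c x) => //.
  by rewrite last_rcons.
- apply/forallP => y; apply/implyP => xy; apply/negP.
  case/connectP=> c pth lst.
  suff: y :: c = [::] by [].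
  by apply: noc; rewrite /= rcons_path pth -lst.
Qed.

Definition skeleton A : rel T := fun x y => arc A x y || arc A y x.

(* The immorality x -> z <- y is encoded as ([set x; y], z), so that it is
   counted once and not once for each ordering of x and y. *)
Definition immoralities A : {set {set T} * T} :=
  [set I | [exists x, exists y,
     [&& x != y, I.1 == [set x; y], arc A x I.2, arc A y I.2
       & ~~ skeleton A x y]]].

End Digraph.

Definition dag_on (G : sgraph) (A : {set G * G}) : bool :=
  acyclic A && [forall x, forall y, skeleton A x y == adj x y].

Definition immorality_number (G : sgraph) : nat :=
  \max_(A : {set G * G} | dag_on A) #|immoralities A|.

(* Every graph has an acyclic orientation, so the maximum is not over an empty
   family. *)
Lemma dag_on_exists (G : sgraph) : exists A : {set G * G}, dag_on A.
Proof.
pose A := [set u : G * G | adj u.1 u.2 && (enum_rank u.1 < enum_rank u.2)].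
exists A; apply/andP; split; last first.
  apply/forallP => x; apply/forallP => y; apply/eqP.
  rewrite /skeleton /arc !inE /= (adj_sym y x) -andb_orr -neq_ltn.
  have [->|nxy] := eqVneq x y; first by rewrite adj_irr.
  suff -> : (enum_rank x != enum_rank y :> nat) by rewrite andbT.
  by apply: contra nxy => /eqP/val_inj/enum_rank_inj ->.
apply/forallP => x; apply/forallP => y; apply/implyP.
rewrite /arc !inE /= => /andP[_ ltxy]; apply/negP => /connectP[c pth lst].
suff /(leq_trans ltxy): enum_rank y <= enum_rank x by rewrite ltnn.
rewrite {}lst; elim: c {x ltxy} y pth => //= z c IHc y /andP[].
rewrite /arc inE => /andP[_ /ltnW leyz] /IHc; exact: leq_trans.
Qed.

Definition cbip_adj m n : rel ('I_m + 'I_n) :=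
  fun u v => match u, v with
             | inl _, inr _ | inr _, inl _ => true
             | _, _ => false
             end.

Lemma cbip_adj_sym m n : symmetric (@cbip_adj m n).
Proof. by move=> [i|i] [j|j]. Qed.

Lemma cbip_adj_irr m n : irreflexive (@cbip_adj m n).
Proof. by move=> [i|i]. Qed.

Definition complete_bipartite m n : sgraph :=
  SGraph (@cbip_adj_sym m n) (@cbip_adj_irr m n).

(* Main.v *)
Require Import Defs.
From mathcomp Require Import all_boot.
(* Otherwise [arc] would be [path.arc]. *)
Import Defs.

Set Implicit Arguments.
Unset Strict Implicit.
Unset Printing Implicit Defensive.

(** In a bipartite graph two parents of the same vertex are never adjacent, so
    an orientation has exactly $\sum_v \binom{d(v)}{2}$ immoralities, where
    $d(v)$ is the in-degree of $v$. In $K_{p,p}$ each $d(v)$ is at most $p$,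
    hence $2\binom{d(v)}{2} = d(v)(d(v)-1) \le d(v)(p-1)$; as the in-degrees sum
    to at most the number $p^2$ of edges, twice the number of immoralities is at
    most $p^2(p-1)$. Orienting all edges from one part to the other gives
    equality. *)

Section Digraph.
Variable T : finType.
Implicit Types A : {set T * T}.

Definition parents A (z : T) : {set T} := [set x | arc A x z].

Lemma card_parents A z : #|parents A z| = \sum_x arc A x z.
Proof.
by rewrite -sum1_card big_mkcond; apply: eq_bigr => x _; rewrite inE; case: arc.
Qed.

(** Under this hypothesis the non-adjacency clause is automatic, so the immoralities at [z] are
    exactly the two-element subsets of [parents A z]. *)
Lemma card_immoralities A :
  (forall x y z, arc A x z -> arc A y z -> ~~ skeleton A x y) ->
  #|immoralities A| = \sum_z 'C(#|parents A z|, 2).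
Proof.
move=> indep; rewrite -sum1_card.
under [RHS]eq_bigr => z _ do rewrite -cards_draws -sum1_card.
(* Summing over the subset first matches the encoding of immoralities as pairs [(S, z)]. *)
rewrite (exchange_big_dep predT) //= pair_big_dep.
apply: eq_bigl => -[S z]; rewrite !inE /=.
apply/existsP/andP => [[x /existsP[y /and5P[nxy /eqP-> xz yz _]]]|].
  by rewrite cards2 nxy subUset !sub1set !inE xz yz.
case=> sub /cards2P[x [y [nxy defS]]]; move: sub.
rewrite {}defS subUset !sub1set !inE => /andP[xz yz].
by exists x; apply/existsP; exists y; rewrite nxy eqxx xz yz (indep _ _ z).
Qed.

Lemma acyclic_arc_antisym A x y : acyclic A -> arc A x y -> ~~ arc A y x.
Proof.
move=> /forallP/(_ x)/forallP/(_ y)/implyP acA /acA.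
by apply: contra; apply: connect1.
Qed.

End Digraph.

Lemma double_bin2 n : 2 * 'C(n, 2) = n * n.-1.
Proof. by rewrite -mul_bin_diag bin1. Qed.

Section CompleteBipartite.
Variables m n : nat.
Local Notation K := (complete_bipartite m n).
Implicit Types A : {set K * K}.

Lemma dag_on_arc_adj A (x y : K) : dag_on A -> arc A x y -> adj x y.
Proof.
by case/andP=> _ /forallP/(_ x)/forallP/(_ y)/eqP <- xy; rewrite /skeleton xy.
Qed.

Lemma dag_on_complete_bipartite_card_immoralities A :
  dag_on A -> #|immoralities A| = \sum_z 'C(#|parents A z|, 2).
Proof.
move=> dagA; apply: card_immoralities => x y z.
move=> /(dag_on_arc_adj dagA) xz /(dag_on_arc_adj dagA) yz.
have /andP[_ /forallP/(_ x)/forallP/(_ y)/eqP->] := dagA.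
by case: x y z xz yz => [x|x] [y|y] [z|z].
Qed.

Lemma card_parents_inl A i :
  dag_on A -> #|parents A (inl i)| = \sum_j arc A (inr j) (inl i).
Proof.
move=> dagA; rewrite card_parents big_sumType /= big1 // => k _.
by case: (boolP (arc _ _ _)) => // /(dag_on_arc_adj dagA).
Qed.

Lemma card_parents_inr A j :
  dag_on A -> #|parents A (inr j)| = \sum_i arc A (inl i) (inr j).
Proof.
move=> dagA; rewrite card_parents big_sumType /= [X in _ + X]big1 ?addn0 // => k _.
by case: (boolP (arc _ _ _)) => // /(dag_on_arc_adj dagA).
Qed.

(** Each pair [(i, j)] carries at most one of its two possible arcs, since acyclicity excludes
    2-cycles. *)
Lemma sum_card_parents_le A : dag_on A -> \sum_z #|parents A z| <= m * n.
Proof.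
move=> dagA; rewrite big_sumType /=.
under eq_bigr => i _ do rewrite card_parents_inl //.
under [X in _ + X]eq_bigr => j _ do rewrite card_parents_inr //.
rewrite [X in _ + X]exchange_big -big_split /= -[m in leqRHS]card_ord -sum_nat_const.
apply: leq_sum => i _; rewrite -big_split /=.
rewrite -[n in leqRHS]card_ord -sum1_card; apply: leq_sum => j _.
have /andP[acA _] := dagA.
case: (boolP (arc A (inr j) (inl i))) => [ji | _]; last by case: arc.
by rewrite (negPf (acyclic_arc_antisym acA ji)).
Qed.

(** All parents lie in the part opposite to [z]. *)
Lemma card_parents_le_maxn A z : dag_on A -> #|parents A z| <= maxn m n.
Proof.
have le_sum k (F : 'I_k -> bool) : \sum_i F i <= k.
  rewrite -[k in leqRHS]card_ord -sum1_card.
  by apply: leq_sum => i _; case: (F i).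
move=> dagA; rewrite leq_max; case: z => [i|j].
  by rewrite card_parents_inl // le_sum orbT.
by rewrite card_parents_inr // le_sum.
Qed.

Definition left_to_right : {set K * K} :=
  [set u : K * K | match u with (inl _, inr _) => true | _ => false end].

Lemma dag_on_left_to_right : dag_on left_to_right.
Proof.
apply/andP; split; apply/forallP => x; apply/forallP => y.
  apply/implyP; case: x y => [x|x] [y|y]; rewrite /arc inE //= => _.
  (* A return path would have to leave a right vertex, and these are sinks. *)
  by apply/negP => /connectP[[|[z|z] c]] //= /andP[]; rewrite inE.
by rewrite /skeleton /arc !inE; case: x y => [x|x] [y|y].
Qed.

Lemma card_immoralities_left_to_right :
  #|immoralities left_to_right| = n * 'C(m, 2).
Proof.
have dagA := dag_on_left_to_right.
rewrite (dag_on_complete_bipartite_card_immoralities dagA) big_sumType /=.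
(* Left vertices are sources and contribute ['C(0, 2)]. *)
rewrite big1 => [|i _]; last first.
  by rewrite card_parents_inl // big1 // => j _; rewrite /arc inE.
rewrite add0n -[n in RHS]card_ord -sum_nat_const; apply: eq_bigr => j _.
rewrite card_parents_inr //; congr 'C(_, 2).
rewrite -[RHS]card_ord -sum1_card.
by apply: eq_bigr => i _; rewrite /arc inE.
Qed.

End CompleteBipartite.

Theorem theorem2p10 (p : nat) :
  immorality_number (complete_bipartite p p) = p * 'C(p, 2).
Proof.
apply/eqP; rewrite eqn_leq; apply/andP; split; last first.
  rewrite -(card_immoralities_left_to_right p p).
  exact: leq_bigmax_cond (dag_on_left_to_right p p).
apply/bigmax_leqP => A dagA.
rewrite dag_on_complete_bipartite_card_immoralities //.
rewrite -(leq_pmul2l (isT : 0 < 2)) mulnCA double_bin2 mulnA.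
(* The intermediate bound is the sum of the in-degrees times [p.-1], to be compared vertex by
   vertex. *)
rewrite (leq_trans _ (leq_mul (sum_card_parents_le dagA) (leqnn p.-1))) //.
rewrite big_distrr big_distrl /=; apply: leq_sum => z _.
have := card_parents_le_maxn z dagA; rewrite maxnn => le_p.
(* Truncated subtraction is monotone, so in-degree 0 needs no separate case. *)
by rewrite double_bin2 leq_mul2l -!subn1 leq_sub2r ?orbT.
Qed.
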